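(* $$3\pi=\sum_{j=0}^{\infty}\left(\frac{16}{27}\right)^{j}\frac{\left(\frac12\right)_j(1)_j\left(\frac32\right)_j}{\left(\frac54\right)_j\left(\frac43\right)_j\left(\frac53\right)_j}\,(11j+4).$$
   Context: $(x)_0=1$ and $(x)_j=x(x+1)\cdots(x+j-1)$ for positive integers $j$ (rising factorial). *)

(* Defs.v *)
From Stdlib Require Import Reals.
From Coquelicot Require Import Coquelicot.
Local Open Scope R_scope.

(* Rising factorial (x)_j = x (x + 1) ... (x + j - 1), with (x)_0 = 1. *)
Fixpoint rising (x : R) (j : nat) : R :=
  match j with
  | O => 1
  | S k => rising x k * (x + INR k)
  end.

(* Main.v *)
Require Import Defs.
From Stdlib Require Import Reals Lra Lia.
From Coquelicot Require Import Coquelicot.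
Local Open Scope R_scope.

(** The series is obtained from Leibniz's series for [PI] by a
    Wilf-Zeilberger pair.  For fixed [n] and varying [k], [wzF n k] is a multiple
    of the general term
      Gamma(a+k) Gamma(b+k) / (Gamma(c+k) Gamma(d+k))
    of Dougall's bilateral 2H2 sum, at
      (a, b, c, d) = (1/4, 3/4 - n, 5/4 + n, 7/4 + n),
    and the factor [head n] is, up to a constant, the reciprocal of the gamma
    quotient that evaluates that sum.  This normalization makes the bilateral sum
    independent of [n], which is why a companion [wzG] with
      wzF (n+1) k - wzF n k = wzG n (k+1) - wzG n k
    exists ([wz_equation]); it is a rational multiple of [wzF].  The shifts are
    chosen so that two things happen on the boundary:
    - for n = 0 the gamma factors collapse and
      wzF 0 k = 24 / ((4k+1)(4k+3)) = 12 (1/(4k+1) - 1/(4k+3)), so that the sum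
      over [k] is 12 (PI / 4) = 3 PI ([wzF_0], [leibniz_paired]);
    - for k = 0, [wzG n 0] is the [n]th term of the series to be summed ([wzG_0]).

    Summing the WZ equation over k >= 0, where [wzG n k] tends to 0 as k grows
    ([wzG_lim]), shows that passing from [n] to [n+1] lowers the sum of
    [wzF n k] over [k] by exactly [wzG n 0] ([wz_step]).  Hence 3 PI minus the
    first N+1 terms of the series equals the sum over [k] of [wzF (N+1) k].  By
    [wzF_bound] and [head_bound] that remainder is at most 3 PI (3/4)^(N+1), so it
    tends to 0. *)

(** * Rising factorials and the hypergeometric factor *)

Lemma rising_gt0 (x : R) (j : nat) : 0 < x -> 0 < rising x j.
Proof.
intros Hx; induction j as [|j IH]; simpl; [lra|].
apply Rmult_lt_0_compat; [exact IH|]. pose proof (pos_INR j); lra.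
Qed.

Lemma rising_shift (x : R) (j : nat) :
  rising (x + 1) j * x = rising x j * (x + INR j).
Proof.
induction j as [|j IH]; [simpl; ring|].
change (rising (x + 1) (S j)) with (rising (x + 1) j * (x + 1 + INR j)).
change (rising x (S j)) with (rising x j * (x + INR j)).
rewrite S_INR, <- IH; ring.
Qed.

Definition hyp (n : nat) : R :=
  (16 / 27) ^ n
  * ((rising (1 / 2) n * rising 1 n * rising (3 / 2) n)
     / (rising (5 / 4) n * rising (4 / 3) n * rising (5 / 3) n)).

Lemma hyp_ratio (n : nat) :
  hyp (S n) = hyp n * (16 / 27 * ((1 / 2 + INR n) * (1 + INR n) * (3 / 2 + INR n))
    / ((5 / 4 + INR n) * (4 / 3 + INR n) * (5 / 3 + INR n))).
Proof.
unfold hyp; simpl.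
pose proof (pos_INR n).
assert (H1 : 0 < rising (5 / 4) n) by (apply rising_gt0; lra).
assert (H2 : 0 < rising (4 / 3) n) by (apply rising_gt0; lra).
assert (H3 : 0 < rising (5 / 3) n) by (apply rising_gt0; lra).
field; repeat split; lra.
Qed.

(** Up to a constant this is
    Gamma(c-a) Gamma(c-b) Gamma(d-a) Gamma(d-b) /
      (Gamma(c) Gamma(d) Gamma(1-b) Gamma(c+d-a-b-1))
    for the parameters (1/4, 3/4 - n, 5/4 + n, 7/4 + n), rewritten in terms of the
    hypergeometric factor of the series.  The constant 12 makes the sum of
    [wzF 0] equal to 3 PI. *)
Definition head (n : nat) : R :=
  12 * ((3 * INR n + 1) * (3 * INR n + 2)) / (4 * INR n + 3) * hyp n.

Lemma head_0 : head 0 = 8.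
Proof. unfold head, hyp; simpl; field. Qed.

Lemma head_ratio (n : nat) :
  head (S n) = head n * (64 / 81 * ((INR n + 1 / 2) * (INR n + 1) * (INR n + 3 / 2) * (INR n + 3 / 4))
    / ((INR n + 5 / 4) * (INR n + 7 / 4) * (INR n + 1 / 3) * (INR n + 2 / 3)) * (3 / 4)).
Proof.
unfold head; rewrite hyp_ratio, S_INR; pose proof (pos_INR n).
field; repeat split; lra.
Qed.

(** The ratio of consecutive values tends to 16/27 but is about 0.69 at n = 0; the
    uniform bound 3/4 on it suffices. *)
Lemma head_bound (n : nat) : 0 <= head n <= 8 * (3 / 4) ^ n.
Proof.
induction n as [|n [IH0 IH]]; [rewrite head_0; simpl; lra|].
rewrite head_ratio; pose proof (pos_INR n) as Hn.
set (D := (INR n + 5 / 4) * (INR n + 7 / 4) * (INR n + 1 / 3) * (INR n + 2 / 3)).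
set (N := 64 / 81 * ((INR n + 1 / 2) * (INR n + 1) * (INR n + 3 / 2) * (INR n + 3 / 4))).
assert (HD : 0 < D) by (unfold D; repeat apply Rmult_lt_0_compat; lra).
assert (HN : 0 <= N) by (unfold N; repeat apply Rmult_le_pos; lra).
assert (HND : N <= D).
{ apply Rminus_le_0.
  pose proof (pow_le _ 2 Hn); pose proof (pow_le _ 3 Hn); pose proof (pow_le _ 4 Hn).
  (* All coefficients of the polynomial [D - N] in [INR n] are nonnegative. *)
  replace (D - N) with (17 / 81 * INR n ^ 4 + (4 - 64 / 81 * (15 / 4)) * INR n ^ 3
    + (2 / 9 + 3 + 35 / 16 - 64 / 81 * 5) * INR n ^ 2
    + (2 / 3 + 35 / 16 - 64 / 81 * (45 / 16)) * INR n + (35 / 72 - 4 / 9))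
    by (unfold D, N; field).
  lra. }
assert (Hr : 0 <= N / D <= 1).
{ split; [apply Rdiv_le_0_compat; lra|].
  apply Rmult_le_reg_r with D; [exact HD|]. unfold Rdiv; rewrite Rmult_assoc, Rinv_l; lra. }
simpl pow; split.
- apply Rmult_le_pos; [exact IH0|]; lra.
- apply Rle_trans with (head n * (3 / 4)); [|lra].
  apply Rmult_le_compat_l; lra.
Qed.

(** * The WZ pair *)

Definition wzF (n k : nat) : R :=
  head n * (rising (1 / 4) k * rising (3 / 4 - INR n) k
            / (rising (5 / 4 + INR n) k * rising (7 / 4 + INR n) k)).

Lemma wzF_ratio_k (n k : nat) :
  wzF n (S k) = wzF n k * ((1 / 4 + INR k) * (3 / 4 - INR n + INR k)
    / ((5 / 4 + INR n + INR k) * (7 / 4 + INR n + INR k))).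
Proof.
unfold wzF; simpl; pose proof (pos_INR n); pose proof (pos_INR k).
assert (H1 : 0 < rising (5 / 4 + INR n) k) by (apply rising_gt0; lra).
assert (H2 : 0 < rising (7 / 4 + INR n) k) by (apply rising_gt0; lra).
field; repeat split; lra.
Qed.

(** Multiplied by 4, the left side is an integer congruent to -1 modulo 4. *)
Lemma quarter_neq0 (n k : nat) : INR k - INR n - 1 / 4 <> 0.
Proof.
rewrite !INR_IZR_INZ; intros H.
assert (E : IZR (4 * Z.of_nat k - 4 * Z.of_nat n - 1) = 0)
  by (rewrite !minus_IZR, !mult_IZR; lra).
apply eq_IZR in E; lia.
Qed.

(** Together with [wzF_ratio_k] this makes both quotients of [wzF] explicit rational
    functions, which turns the WZ equation into a rational identity. *)
Lemma wzF_ratio_n (n k : nat) :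
  wzF (S n) k = wzF n k * (16 / 27 * ((1 / 2 + INR n) * (1 + INR n) * (3 / 2 + INR n))
    * (3 * INR n + 4) * (3 * INR n + 5) * (4 * INR n + 3)
    / ((5 / 4 + INR n) * (4 / 3 + INR n) * (5 / 3 + INR n)
       * (4 * INR n + 7) * (3 * INR n + 1) * (3 * INR n + 2))
    * ((- INR n - 1 / 4) * (5 / 4 + INR n) * (7 / 4 + INR n))
    / ((INR k - INR n - 1 / 4) * (5 / 4 + INR n + INR k) * (7 / 4 + INR n + INR k))).
Proof.
pose proof (pos_INR n); pose proof (pos_INR k); pose proof (quarter_neq0 n k).
assert (H2 : 0 < rising (5 / 4 + INR n) k) by (apply rising_gt0; lra).
assert (H3 : 0 < rising (7 / 4 + INR n) k) by (apply rising_gt0; lra).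
unfold wzF, head; rewrite hyp_ratio, S_INR.
replace (3 / 4 - (INR n + 1)) with (- INR n - 1 / 4) by lra.
replace (5 / 4 + (INR n + 1)) with (5 / 4 + INR n + 1) by lra.
replace (7 / 4 + (INR n + 1)) with (7 / 4 + INR n + 1) by lra.
assert (E1 : rising (- INR n - 1 / 4) k
  = rising (3 / 4 - INR n) k * (- INR n - 1 / 4) / (INR k - INR n - 1 / 4)).
{ replace (3 / 4 - INR n) with (- INR n - 1 / 4 + 1) by lra.
  rewrite rising_shift; field; lra. }
assert (E : forall x, 0 < x -> rising (x + 1) k = rising x k * (x + INR k) / x).
{ intros x Hx; rewrite <- rising_shift; field; lra. }
rewrite E1, !E by lra.
field; repeat split; lra.
Qed.

(** This is the quadratic polynomial in [k] that solves
      rho (b-1) c d - (c+k)(d+k)(b-1+k) = (a+k)(b-1+k) p(k+1) - (c+k)(d+k) p(k),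
    where (a, b, c, d) = (1/4, 3/4 - n, 5/4 + n, 7/4 + n) and rho is the quotient
    of [head (S n)] by [head n]; this equation is the WZ equation divided by
    [wzF n k], with denominators cleared, for the companion wzF n k p(k) / (b-1+k). *)
Definition cert (n k : nat) : R :=
  (- ((11 * INR n + 4) * (4 * INR n + 3) * (4 * INR n + 1) / 48)
   + (2 * INR n + 1) * (2 * INR n + 3) / 2 * INR k + (3 * INR n + 2) * INR k ^ 2)
  / ((3 * INR n + 1) * (3 * INR n + 2)).

Definition wzG (n k : nat) : R := wzF n k * cert n k / (INR k - INR n - 1 / 4).

Lemma wz_equation (n k : nat) :
  wzF (S n) k - wzF n k = wzG n (S k) - wzG n k.
Proof.
pose proof (pos_INR n); pose proof (pos_INR k); pose proof (quarter_neq0 n k).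
pose proof (quarter_neq0 n (S k)) as Hk; rewrite S_INR in Hk.
unfold wzG, cert; rewrite wzF_ratio_n, wzF_ratio_k, S_INR.
field; repeat split; lra.
Qed.

Lemma wzG_0 (n : nat) : wzG n 0 = hyp n * (11 * INR n + 4).
Proof.
unfold wzG, cert, wzF, head; simpl; pose proof (pos_INR n).
field; repeat split; lra.
Qed.

Lemma wzF_0 (k : nat) : wzF 0 k = 24 / ((4 * INR k + 1) * (4 * INR k + 3)).
Proof.
induction k as [|k IH].
- unfold wzF; rewrite head_0; simpl; field.
- rewrite wzF_ratio_k, IH, S_INR; simpl INR; pose proof (pos_INR k).
  field; repeat split; lra.
Qed.

(** * Bounds and limits *)

(** The quotient of consecutive values of [wzF n] is, in absolute value, largest at
    n = 0 when [k] is fixed.  Cleared of denominators, this is an inequality between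
    polynomials in [x] and [y], checked according to the sign of 3/4 - x + y. *)
Lemma ratio_k_bound (x y : R) : 0 <= x -> 0 <= y ->
  Rabs ((1 / 4 + y) * (3 / 4 - x + y) / ((5 / 4 + x + y) * (7 / 4 + x + y)))
  <= (1 / 4 + y) * (3 / 4 + y) / ((5 / 4 + y) * (7 / 4 + y)).
Proof.
intros Hx Hy.
assert (HD : 0 < (5 / 4 + x + y) * (7 / 4 + x + y))
  by (apply Rmult_lt_0_compat; lra).
assert (HE : 0 < (5 / 4 + y) * (7 / 4 + y)) by (apply Rmult_lt_0_compat; lra).
rewrite Rabs_div, Rabs_mult, (Rabs_pos_eq (1 / 4 + y)), (Rabs_pos_eq ((5 / 4 + x + y) * _)) by lra.
apply Rle_div_l; [exact HD|].
replace ((1 / 4 + y) * (3 / 4 + y) / ((5 / 4 + y) * (7 / 4 + y))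
         * ((5 / 4 + x + y) * (7 / 4 + x + y)))
  with ((1 / 4 + y) * ((3 / 4 + y) * ((5 / 4 + x + y) * (7 / 4 + x + y))
        / ((5 / 4 + y) * (7 / 4 + y)))) by (field; lra).
apply Rmult_le_compat_l; [lra|].
apply Rle_div_r; [exact HE|].
assert (P1 := Rmult_le_pos _ _ Hx Hy).
assert (P2 := Rmult_le_pos _ _ Hx Hx).
assert (P3 := Rmult_le_pos _ _ Hy Hy).
assert (P4 := Rmult_le_pos _ _ P1 Hy).
assert (P5 := Rmult_le_pos _ _ P1 Hx).
assert (P6 := Rmult_le_pos _ _ P3 Hy).
destruct (Rle_dec 0 (3 / 4 - x + y));
  [rewrite Rabs_pos_eq by lra | rewrite Rabs_left by lra]; nra.
Qed.

(** Domination by a multiple of the case n = 0: it controls both the decay in [k]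
    for fixed [n] and the sum over [k] as [n] grows. *)
Lemma wzF_bound (n k : nat) : Rabs (wzF n k) <= head n / 8 * wzF 0 k.
Proof.
pose proof (head_bound n) as [Hh _].
induction k as [|k IH].
- unfold wzF; rewrite head_0; simpl.
  rewrite Rabs_pos_eq; lra.
- rewrite !wzF_ratio_k, Rabs_mult, <- Rmult_assoc; simpl INR.
  rewrite Rminus_0_r, !Rplus_0_r.
  apply Rmult_le_compat; [apply Rabs_pos|apply Rabs_pos|exact IH|].
  apply ratio_k_bound; apply pos_INR.
Qed.

(** Grouping Leibniz's series in consecutive pairs: 12 (1/(4k+1) - 1/(4k+3)). *)
Lemma leibniz_paired : is_series (wzF 0) (3 * PI).
Proof.
assert (Te : forall m, tg_alt PI_tg (2 * m) = / (4 * INR m + 1)).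
{ intros m; unfold tg_alt, PI_tg; rewrite pow_1_even, plus_INR, !mult_INR.
  simpl INR; rewrite Rmult_1_l; f_equal; ring. }
assert (To : forall m, tg_alt PI_tg (S (2 * m)) = - / (4 * INR m + 3)).
{ intros m; unfold tg_alt, PI_tg; rewrite pow_1_odd.
  replace (2 * S (2 * m) + 1)%nat with (4 * m + 3)%nat by lia.
  rewrite plus_INR, mult_INR; simpl INR.
  pose proof (pos_INR m); field; lra. }
assert (E : forall K, @eq R (sum_n (wzF 0) K) (12 * sum_f_R0 (tg_alt PI_tg) (S (2 * K)))).
{ intros K; pose proof (pos_INR K); induction K as [|K IH].
  - rewrite sum_O, wzF_0, tech5, To.
    change (sum_f_R0 (tg_alt PI_tg) (2 * 0)) with (tg_alt PI_tg (2 * 0)).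
    rewrite Te; simpl INR; field.
  - rewrite sum_Sn, IH, wzF_0 by apply pos_INR.
    replace (S (2 * S K)) with (S (S (S (2 * K)))) by lia.
    rewrite (tech5 _ (S (S (2 * K)))), (tech5 _ (S (2 * K))).
    replace (S (S (2 * K))) with (2 * S K)%nat by lia.
    rewrite Te, To; change plus with Rplus; field; lra. }
change (is_lim_seq (sum_n (wzF 0)) (3 * PI)).
apply is_lim_seq_ext with (fun K => 12 * sum_f_R0 (tg_alt PI_tg) (S (2 * K))).
{ intros K; symmetry; apply E. }
replace (3 * PI) with (12 * (PI / 4)) by field.
apply (is_lim_seq_scal_l _ 12 (PI / 4)).
rewrite <- Alt_PI_eq; unfold Alt_PI; destruct exist_PI as [l Hl].
replace (4 * l / 4) with l by field.
apply (is_lim_seq_subseq (sum_f_R0 (tg_alt PI_tg)) l (fun K => S (2 * K))).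
- apply eventually_subseq; intros K; lia.
- apply is_lim_seq_Reals, Hl.
Qed.

(** By [wzF_bound], [wzF n k] is of order at most 1/k^2, and [cert n k] is quadratic
    in [k]; their product is therefore bounded, and the remaining factor
    1 / (k - n - 1/4) tends to 0. *)
Lemma wzG_lim (n : nat) : is_lim_seq (wzG n) 0.
Proof.
pose proof (pos_INR n) as Hn; destruct (head_bound n) as [Hh _].
set (A := (11 * INR n + 4) * (4 * INR n + 3) * (4 * INR n + 1) / 48).
set (B := (2 * INR n + 1) * (2 * INR n + 3) / 2).
set (C := 3 * INR n + 2).
assert (HA : 0 <= A) by (unfold A; repeat apply Rmult_le_pos; lra).
assert (HB : 0 <= B) by (unfold B; repeat apply Rmult_le_pos; lra).
assert (HC : 0 <= C) by (unfold C; lra).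
set (M := head n / 8 * 24 * (A + B + C)).
assert (bound : forall k, Rabs (wzF n k * cert n k) <= M).
{ intros k; pose proof (pos_INR k) as Hk.
  assert (H1 : Rabs (cert n k) <= (A + B + C) * (1 + INR k) ^ 2).
  { unfold cert; fold A B C.
    assert (HD : 1 <= (3 * INR n + 1) * C) by (unfold C; nra).
    rewrite Rabs_div, (Rabs_pos_eq (_ * C)) by lra.
    apply Rle_div_l; [lra|].
    assert (HX : Rabs (- A + B * INR k + C * INR k ^ 2) <= (A + B + C) * (1 + INR k) ^ 2).
    { assert (Q1 := Rmult_le_pos _ _ HA Hk). assert (Q2 := Rmult_le_pos _ _ HB Hk).
      assert (Q3 := Rmult_le_pos _ _ HC Hk).
      assert (Q4 := Rmult_le_pos _ _ Q1 Hk). assert (Q5 := Rmult_le_pos _ _ Q2 Hk).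
      assert (Q6 := Rmult_le_pos _ _ Q3 Hk).
      apply Rabs_le; split; nra. }
    apply Rle_trans with (1 := HX).
    rewrite <- (Rmult_1_r ((A + B + C) * (1 + INR k) ^ 2)) at 1.
    apply Rmult_le_compat_l; [|exact HD].
    apply Rmult_le_pos; [lra|apply pow2_ge_0]. }
  assert (H2 := wzF_bound n k); rewrite wzF_0 in H2.
  rewrite Rabs_mult.
  apply Rle_trans with (1 := Rmult_le_compat _ _ _ _ (Rabs_pos _) (Rabs_pos _) H2 H1).
  replace (head n / 8 * (24 / ((4 * INR k + 1) * (4 * INR k + 3))) * ((A + B + C) * (1 + INR k) ^ 2))
    with (M * ((1 + INR k) ^ 2 / ((4 * INR k + 1) * (4 * INR k + 3))))
    by (unfold M; field; lra).
  rewrite <- (Rmult_1_r M) at 2; apply Rmult_le_compat_l.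
  - unfold M; apply Rmult_le_pos; lra.
  - apply Rle_div_l; nra. }
assert (H0 : is_lim_seq (fun k => M * / Rabs (INR k - INR n - 1 / 4)) 0).
{ replace 0 with (M * 0) by ring.
  apply (is_lim_seq_scal_l _ M 0).
  apply (is_lim_seq_inv _ p_infty); [|discriminate].
  apply is_lim_seq_le_p_loc with (fun k => INR k - (INR n + 1 / 4)).
  - exists 0%nat; intros k _.
    apply Rle_trans with (2 := Rle_abs _); lra.
  - apply is_lim_seq_minus with (1 := is_lim_seq_INR) (2 := is_lim_seq_const _).
    reflexivity. }
apply is_lim_seq_abs_0.
apply is_lim_seq_le_le with (fun _ => 0) (fun k => M * / Rabs (INR k - INR n - 1 / 4)).
- intros k; split; [apply Rabs_pos|].
  pose proof (quarter_neq0 n k) as Hq.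
  unfold wzG; rewrite Rabs_div by exact Hq.
  apply Rmult_le_compat_r; [|apply bound].
  left; apply Rinv_0_lt_compat, Rabs_pos_lt, Hq.
- apply is_lim_seq_const.
- exact H0.
Qed.

(** * Telescoping *)

(** Summing the WZ equation over k <= K leaves the boundary terms
    [wzG n (S K)], which vanishes in the limit, and [wzG n 0]. *)
Lemma wz_step (n : nat) (s : R) :
  is_series (wzF n) s -> is_series (wzF (S n)) (s - wzG n 0).
Proof.
intros Hs.
change (is_lim_seq (sum_n (wzF (S n))) (s - wzG n 0)).
apply is_lim_seq_ext with (fun K => sum_n (wzF n) K + (wzG n (S K) - wzG n 0)).
{ intros K; induction K as [|K IH].
  - rewrite !sum_O; pose proof (wz_equation n 0); lra.
  - rewrite !sum_Sn, <- IH; change plus with Rplus.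
    pose proof (wz_equation n (S K)); lra. }
replace (s - wzG n 0) with (s + (0 - wzG n 0)) by ring.
apply (is_lim_seq_plus' _ _ s (0 - wzG n 0)); [exact Hs|].
apply is_lim_seq_minus'; [|apply is_lim_seq_const].
apply (is_lim_seq_incr_1 (wzG n)), wzG_lim.
Qed.

Lemma remainder_series (N : nat) :
  is_series (wzF (S N)) (3 * PI - sum_n (fun n => wzG n 0) N).
Proof.
induction N as [|N IH].
- rewrite sum_O; apply wz_step, leibniz_paired.
- rewrite sum_Sn; change plus with Rplus.
  replace (3 * PI - (sum_n (fun n => wzG n 0) N + wzG (S N) 0))
    with (3 * PI - sum_n (fun n => wzG n 0) N - wzG (S N) 0) by ring.
  apply wz_step, IH.
Qed.

Lemma remainder_bound (n : nat) (s : R) :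
  is_series (wzF n) s -> Rabs s <= head n / 8 * (3 * PI).
Proof.
intros Hs.
assert (H0 := is_series_scal_l (head n / 8) _ _ leibniz_paired).
apply (is_lim_seq_le (fun K => Rabs (sum_n (wzF n) K))
  (sum_n (fun k => scal (head n / 8) (wzF 0 k))) (Rabs s) (head n / 8 * (3 * PI))).
- intros K; induction K as [|K IH].
  + rewrite !sum_O; apply wzF_bound.
  + rewrite !sum_Sn; change plus with Rplus.
    apply Rle_trans with (1 := Rabs_triang _ _).
    apply Rplus_le_compat; [exact IH|apply wzF_bound].
- exact (is_lim_seq_abs _ (Finite s) Hs).
- exact H0.
Qed.

Theorem mainTheorem5 :
  is_series
    (fun j : nat =>
       (16 / 27) ^ j
       * ((rising (1 / 2) j * rising 1 j * rising (3 / 2) j)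
          / (rising (5 / 4) j * rising (4 / 3) j * rising (5 / 3) j))
       * (11 * INR j + 4))
    (3 * PI).
Proof.
apply is_series_ext with (fun n => wzG n 0); [exact wzG_0|].
change (is_lim_seq (sum_n (fun n => wzG n 0)) (3 * PI)).
apply is_lim_seq_ext with
  (fun N => 3 * PI - (3 * PI - sum_n (fun n => wzG n 0) N)); [intros N; ring|].
replace (Finite (3 * PI)) with (Finite (3 * PI - 0)) by (f_equal; ring).
apply is_lim_seq_minus'; [apply is_lim_seq_const|].
apply is_lim_seq_abs_0.
apply is_lim_seq_le_le with (fun _ => 0) (fun N => 3 * PI * (3 / 4) ^ S N).
- intros N; split; [apply Rabs_pos|].
  apply Rle_trans with (1 := remainder_bound _ _ (remainder_series N)).
  destruct (head_bound (S N)) as [_ Hh]; pose proof PI_RGT_0.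
  rewrite Rmult_comm; apply Rmult_le_compat_l; lra.
- apply is_lim_seq_const.
- replace 0 with (3 * PI * 0) by ring.
  apply (is_lim_seq_scal_l _ (3 * PI) 0).
  apply (is_lim_seq_incr_1 (fun N => (3 / 4) ^ N)), is_lim_seq_geom.
  rewrite Rabs_pos_eq; lra.
Qed.
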